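(* The inscribed quadrics of the extended oloid $\mathcal{O}$ are given by $$\mathcal{Q}_\lambda=\left\{(x,y,z)\in\mathbb{R}^3\;\big|\;f_\lambda(x,y,z)=0\right\}$$ with $$f_\lambda(x,y,z)=\frac{x^2}{1-\lambda}+\frac{\left(y-\lambda+\frac12\right)^2}{1-\lambda+\lambda^2}+\frac{z^2}{\lambda}-1,$$ where $\lambda$ is the system parameter.
   Context: Let $k_A=\{(x,y,z)\in\mathbb{R}^3: x^2+(y+\frac12)^2=1,\ z=0\}$ and $k_B=\{(x,y,z)\in\mathbb{R}^3: (y-\frac12)^2+z^2=1,\ x=0\}$. The oloid is the convex hull of $k_A\cup k_B$. Its surface is part of a developable surface, the extended oloid $\mathcal{O}$, which is the union of the generating lines $x=\omega_1(m,t)$, $y=\omega_2(m,t)$, $z=\pm\omega_3(m,t)$, $m\in\mathbb{R}$, for $t\in[-\frac{2\pi}3,\frac{2\pi}3]$, where $$\omega_1=(1-m)\sin t,\quad \omega_2=(1-m)\left(-\tfrac12-\cos t\right)+m\left(\tfrac12-\tfrac{\cos t}{1+\cos t}\right),\quad \omega_3=\frac{m\sqrt{1+2\cos t}}{1+\cos t}.$$ Each generating line joins a point of $k_A$ ($m=0$) to a point of $k_B$ ($m=1$), and the tangent plane of $\mathcal{O}$ along it is tangent to both circles. Use homogeneous point coordinates $x=x_1/x_0$, $y=x_2/x_0$, $z=x_3/x_0$ and homogeneous plane coordinates $[u_0,u_1,u_2,u_3]$ (the plane $u_0x_0+u_1x_1+u_2x_2+u_3x_3=0$). In plane coordinates the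 circles $k_A$ and $k_B$ are given by $F_0=0$ and $F_1=0$, respectively (the equations satisfied by the planes tangent to the respective circle), where $$F_0=4u_0^2-4u_0u_2-4u_1^2-3u_2^2,\qquad F_1=4u_0^2+4u_0u_2-3u_2^2-4u_3^2.$$ The inscribed quadrics of $\mathcal{O}$ are the members of the tangential system of quadrics determined by $k_A$ and $k_B$, i.e. the quadric with system parameter $\lambda$ is the one whose tangent planes are the planes with $(1-\lambda)F_0+\lambda F_1=0$. Conventions for the exceptional parameter values: for $\lambda=0$ and $\lambda=1$ the quadric degenerates to a conic, and $\mathcal{Q}_0=k_A$, $\mathcal{Q}_1=k_B$; the value $\lambda=\pm\infty$ (the member $F_1-F_0=0$ of the system) is understood through $\lim_{\lambda\to\pm\infty}\lambda f_\lambda(x,y,z)=-x^2+z^2-2y$, i.e. $\mathcal{Q}_{\pm\infty}$ is $x^2-z^2+2y=0$. *)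

(* Defs.v *)
From HB Require Import structures.
From mathcomp Require Import all_boot all_order all_algebra.
From mathcomp Require Import boolp classical_sets reals constructive_ereal.

Set Implicit Arguments.
Unset Strict Implicit.
Unset Printing Implicit Defensive.

Import Order.TTheory GRing.Theory Num.Theory.

Local Open Scope classical_set_scope.
Local Open Scope ring_scope.

(* MathComp-Analysis. A point (x, y, z) of R^3 is p : 'rV[R]_3 with entries
   p 0 0, p 0 1, p 0 2. Homogeneous point coordinates and homogeneous plane
   coordinates are row vectors in 'rV[R]_4; the plane u consists of the points x
   with u *m x^T = 0, and nonzero multiples of u denote the same plane. *)

Section Oloid.
Variable R : realType.

Definition circle_A : set 'rV[R]_3 :=
  [set p | p 0 0 ^+ 2 + (p 0 1 + 2^-1) ^+ 2 = 1 /\ p 0 2 = 0].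

Definition circle_B : set 'rV[R]_3 :=
  [set p | (p 0 1 - 2^-1) ^+ 2 + p 0 2 ^+ 2 = 1 /\ p 0 0 = 0].

Definition F0 (u : 'rV[R]_4) : R :=
  4 * u 0 0 ^+ 2 - 4 * u 0 0 * u 0 2 - 4 * u 0 1 ^+ 2 - 3 * u 0 2 ^+ 2.

Definition F1 (u : 'rV[R]_4) : R :=
  4 * u 0 0 ^+ 2 + 4 * u 0 0 * u 0 2 - 3 * u 0 2 ^+ 2 - 4 * u 0 3 ^+ 2.

(* Both infinities denote the same member F1 - F0 = 0. *)
Definition system_form (lam : \bar R) (u : 'rV[R]_4) : R :=
  match lam with
  | EFin l => (1 - l) * F0 u + l * F1 u
  | _ => F1 u - F0 u
  end.

(* Real projective quadric loci: a quadric surface x A x^T = 0, or, since members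
   of a tangential system may degenerate to a conic, the section of such a surface
   by the plane l. *)
Inductive quadric : Type :=
| Surface (A : 'M[R]_4) of A^T = A & A != 0
| Conic (A : 'M[R]_4) (l : 'rV[R]_4) of A^T = A & A != 0 & l != 0.

Definition on_quadric (X : quadric) (p : 'rV[R]_4) : Prop :=
  match X with
  | Surface A _ _ => p *m A *m p^T = 0
  | Conic A l _ _ _ => p *m A *m p^T = 0 /\ l *m p^T = 0
  end.

(* The plane u is tangent to X at the regular point p. Up to the factor 2, the
   row p *m A is the gradient of x A x^T at p, so u is tangent to a surface iff it
   is proportional to p *m A. It is tangent to a conic iff it contains the tangent
   line, which is the intersection of the planes p *m A and l. *)
Definition tangent_at (X : quadric) (u p : 'rV[R]_4) : Prop :=
  on_quadric X p /\
  match X with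
  | Surface A _ _ => row_free (p *m A) /\ (u <= p *m A)%MS
  | Conic A l _ _ _ =>
      row_free (col_mx (p *m A) l) /\ (u <= col_mx (p *m A) l)%MS
  end.

(* The point of contact may lie in the plane at infinity. *)
Definition tangent_plane (X : quadric) (u : 'rV[R]_4) : Prop :=
  u != 0 /\ exists p : 'rV[R]_4, tangent_at X u p.

Definition homogeneous (q : 'rV[R]_3) : 'rV[R]_4 :=
  row_mx (const_mx 1 : 'rV[R]_1) q.

Definition affine_points (X : quadric) : set 'rV[R]_3 :=
  [set q | on_quadric X (homogeneous q)].

(* S is the point set in R^3 of the member with system parameter lam of the
   tangential system determined by the two circles; these members are, by
   definition, the inscribed quadrics of the extended oloid. *)
Definition inscribed_quadric (lam : \bar R) (S : set 'rV[R]_3) : Prop :=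
  exists X : quadric, S = affine_points X /\
    forall u : 'rV[R]_4, u != 0 -> (tangent_plane X u <-> system_form lam u = 0).

Definition f (l : R) (p : 'rV[R]_3) : R :=
  p 0 0 ^+ 2 / (1 - l) + (p 0 1 - l + 2^-1) ^+ 2 / (1 - l + l ^+ 2)
  + p 0 2 ^+ 2 / l - 1.

(* At infinity, l * f l p tends to - x^2 + z^2 - 2y as l tends to +oo or -oo. *)
Definition Q (lam : \bar R) : set 'rV[R]_3 :=
  match lam with
  | EFin l => if l == 0 then circle_A
              else if l == 1 then circle_B
              else [set p | f l p = 0]
  | _ => [set p | p 0 0 ^+ 2 - p 0 2 ^+ 2 + 2 * p 0 1 = 0]
  end.

End Oloid.

(* Main.v *)
Require Import Defs.
From mathcomp Require Import all_boot all_order all_algebra.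
From mathcomp Require Import boolp classical_sets reals constructive_ereal.
From mathcomp Require Import ring lra.

(** The tangent planes of a regular quadric surface [p *m A *m p^T = 0] are the
    zeros of the form of the inverse matrix of [A]: the plane [p *m A] touches
    the surface at [p], and a row [u] is of this kind for a point [p] of the
    surface exactly when [u *m invmx A *m u^T = 0].  Every member of the
    tangential system is given by a matrix [D] in plane coordinates, so for
    parameters other than 0 and 1 the quadric is found by inverting [D], and the
    inverse turns out, up to the factor -4, to be the matrix of [f l].

    The harder direction is uniqueness: no quadric other than [Q lam], regular or
    not, may have the zeros of [D] as its tangent planes.  All the forms [D] of
    the system are indefinite, and a real indefinite form is determined up to a
    factor by its zeros ([proportional_of_zeros]).  Applied to the square of a
    linear form, this also shows that the zeros of [D] lie in no hyperplane
    ([zeros_not_in_hyperplane]).  Two consequences settle the question.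
    - A surface [A] with these tangent planes has no singular point, since all
      its tangent planes would pass through that point; hence [A] is invertible,
      and its inverse is proportional to [D] ([inverse_of_contact_planes]).
    - If a conic in the plane [l] has these tangent planes, then [u + l] is
      tangent whenever [u] is, so [l] is in the kernel of [D] ([conic_kernel]).
      Dropping the coordinate of [l] turns tangent planes of the conic into
      tangent lines of a regular plane conic, to which the argument for surfaces
      applies ([conic_points_of_contact_planes]).

    For parameters other than 0 and 1, and at infinity, [D] is invertible, which
    excludes conics; for 0 and 1 its kernel is the coordinate plane of the
    circle, which excludes surfaces. *)

Set Implicit Arguments.
Unset Strict Implicit.
Unset Printing Implicit Defensive.

Import Order.TTheory GRing.Theory Num.Theory.
Local Open Scope ring_scope.

(** * Real quadratic forms and their zeros *)

Section Forms.
Variable R : rcfType.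

Definition bform n (A : 'M[R]_n) (u v : 'rV[R]_n) : R := (u *m A *m v^T) 0 0.

Definition indefinite n (A : 'M[R]_n) : Prop :=
  exists x y, 0 < bform A x x /\ bform A y y < 0.

Lemma mx11_eq0 (M : 'M[R]_1) : (M = 0) <-> (M 0 0 = 0).
Proof.
split=> [->|h]; first by rewrite mxE.
by apply/matrixP=> i j; rewrite !ord1 h mxE.
Qed.

Lemma bform_eq0 n (A : 'M[R]_n) (p : 'rV[R]_n) :
  p *m A *m p^T = 0 <-> bform A p p = 0.
Proof. exact: mx11_eq0. Qed.

Lemma bformC n (A : 'M[R]_n) (u v : 'rV[R]_n) :
  A^T = A -> bform A u v = bform A v u.
Proof.
move=> sA; rewrite /bform -[in LHS](trmxK (u *m A *m v^T)) mxE.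
by rewrite !trmx_mul trmxK sA mulmxA.
Qed.

Lemma bformDr n (A : 'M[R]_n) u v w :
  bform A u (v + w) = bform A u v + bform A u w.
Proof. by rewrite /bform linearD mulmxDr mxE. Qed.

Lemma bformDl n (A : 'M[R]_n) u v w :
  bform A (v + w) u = bform A v u + bform A w u.
Proof. by rewrite /bform !mulmxDl mxE. Qed.

Lemma bformZr n (A : 'M[R]_n) t u v : bform A u (t *: v) = t * bform A u v.
Proof. by rewrite /bform linearZ -scalemxAr mxE. Qed.

Lemma bformZl n (A : 'M[R]_n) t u v : bform A (t *: u) v = t * bform A u v.
Proof. by rewrite /bform -!scalemxAl mxE. Qed.

Lemma bform0 n (A : 'M[R]_n) v : bform A 0 v = 0.
Proof. by rewrite /bform !mul0mx mxE. Qed.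

Lemma bformZm n (A : 'M[R]_n) c u v : bform (c *: A) u v = c * bform A u v.
Proof. by rewrite /bform -scalemxAr -scalemxAl mxE. Qed.

Lemma bform_line n (A : 'M[R]_n) x y t : A^T = A ->
  bform A (x + t *: y) (x + t *: y) =
  bform A x x + 2 * t * bform A x y + t ^+ 2 * bform A y y.
Proof.
move=> sA; rewrite !(bformDl, bformDr, bformZl, bformZr) (bformC y x sA).
by ring.
Qed.

Lemma bform_delta n (A : 'M[R]_n) i j :
  bform A (delta_mx 0 i) (delta_mx 0 j) = A i j.
Proof. by rewrite /bform -rowE trmx_delta -colE !mxE. Qed.

Lemma sym_ext n (A B : 'M[R]_n) : A^T = A -> B^T = B ->
  (forall u, bform A u u = bform B u u) -> A = B.
Proof.
move=> sA sB h; apply/matrixP=> i j; rewrite -!bform_delta.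
have := h (delta_mx 0 i + 1 *: delta_mx 0 j).
rewrite !bform_line // !h => e; lra.
Qed.

(** The line through [x] and [y] meets the zeros of [D] in two distinct points.
    The restriction of [E] to the line vanishes there too, so it is a multiple of
    the restriction of [D]. *)
Lemma proportional_of_opposite_signs n (D E : 'M[R]_n) x y :
    D^T = D -> E^T = E -> (forall u, bform D u u = 0 -> bform E u u = 0) ->
    0 < bform D x x -> bform D y y < 0 ->
  bform E x x * bform D y y = bform E y y * bform D x x.
Proof.
move=> sD sE DE.
set c := bform D x x; set a := bform D y y; set b := bform D x y => c0 a0.
pose s := Num.sqrt (b ^+ 2 - a * c).
have d0 : 0 < b ^+ 2 - a * c by nra.
have s2 : s ^+ 2 = b ^+ 2 - a * c by rewrite sqr_sqrtr // ltW.
have s0 : 0 < s by rewrite sqrtr_gt0.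
have an0 : a != 0 by rewrite lt_eqF.
(* The points [x + t *: y] with [t = (r - b) / a], [r = s] or [r = - s], are
   the zeros of [D] on the line. *)
have root r : r ^+ 2 = s ^+ 2 ->
    bform E x x * a ^+ 2 + 2 * (r - b) * a * bform E x y
      + (r - b) ^+ 2 * bform E y y = 0.
  move=> r2; have /DE : bform D (x + ((r - b) / a) *: y)
                              (x + ((r - b) / a) *: y) = 0.
    rewrite bform_line // -/a -/b -/c.
    have -> : c + 2 * ((r - b) / a) * b + ((r - b) / a) ^+ 2 * a =
              (a * c - b ^+ 2 + r ^+ 2) / a by field.
    by rewrite r2 s2 addrA subrK subrr mul0r.
  rewrite bform_line // => /(congr1 ( *%R (a ^+ 2))); rewrite mulr0 => <-.
  by field.
have e1 := root s erefl.
have e2 := root (- s) (sqrrN s).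
set e := bform E x x in e1 e2 *; set g := bform E x y in e1 e2.
set h := bform E y y in e1 e2 *.
have e3 : a * g = b * h.
  have : 4 * s * (a * g - b * h) = 0.
    by rewrite -(subrr 0) -{1}e1 -e2; ring.
  move/eqP; rewrite mulf_eq0 (negbTE (lt0r_neq0 _)) ?mulr_gt0 //=.
  by rewrite subr_eq0 => /eqP.
have : a * (e * a - h * c) = 0.
  have -> : a * (e * a - h * c) =
    e * a ^+ 2 + 2 * (s - b) * a * g + (s - b) ^+ 2 * h
     - 2 * (s - b) * (a * g - b * h) - h * (s ^+ 2 - (b ^+ 2 - a * c)).
    by ring.
  by rewrite e1 e3 s2 !subrr !mulr0 !subr0.
by move/eqP; rewrite mulf_eq0 (negbTE an0) /= subr_eq0 => /eqP.
Qed.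

(** The ratio of [E] to [D] at a point where [D] is positive equals the ratio at
    any point where [D] is negative, so all these ratios are equal. *)
Lemma proportional_of_zeros n (D E : 'M[R]_n) :
    D^T = D -> E^T = E -> indefinite D ->
    (forall u, bform D u u = 0 -> bform E u u = 0) ->
  exists c, E = c *: D.
Proof.
move=> sD sE [x [y [x0 y0]]] DE.
have xy := proportional_of_opposite_signs sD sE DE.
have yn : bform D y y != 0 by rewrite lt_eqF.
have xn : bform D x x != 0 by rewrite gt_eqF.
exists (bform E y y / bform D y y); apply: sym_ext => // [|u].
  by rewrite linearZ /= sD.
rewrite bformZm; case: (ltgtP (bform D u u) 0) => [u0|u0|u0].
- have e1 := xy _ _ x0 u0; have e2 := xy _ _ x0 y0.
  apply: (mulIf xn); rewrite -e1.
  have -> : bform E x x = bform E y y * bform D x x / bform D y y.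
    by rewrite -e2 mulfK.
  by field.
- by apply: (mulIf yn); rewrite (xy _ _ u0 y0); field.
- by rewrite u0 mulr0 DE.
Qed.

Lemma mulmx_tr_self_eq0 n (v : 'rV[R]_n) : v *m v^T = 0 -> v = 0.
Proof.
move/mx11_eq0; rewrite mxE => /eqP.
rewrite psumr_eq0 => [/allP h|i _]; last by rewrite mxE -expr2 sqr_ge0.
apply/rowP=> i; have := h i (mem_index_enum i).
by rewrite mxE -expr2 sqrf_eq0 mxE => /eqP.
Qed.

(** The square of the linear form [v] vanishes on the zeros of [D], hence is a
    multiple of [D]; being of constant sign, it is zero. *)
Lemma zeros_not_in_hyperplane n (D : 'M[R]_n) (v : 'rV[R]_n) :
    D^T = D -> indefinite D ->
    (forall u, bform D u u = 0 -> u *m v^T = 0) -> v = 0.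
Proof.
move=> sD iD h.
have bE u : bform (v^T *m v) u u = ((u *m v^T) 0 0) ^+ 2.
  rewrite /bform mulmxA -mulmxA mxE big_ord1 -[v *m u^T]trmxK.
  by rewrite trmx_mul trmxK [X in _ * X]mxE.
have [||c cE] := @proportional_of_zeros _ D (v^T *m v) sD _ iD.
- by rewrite trmx_mul trmxK.
- by move=> u /h; rewrite bE => ->; rewrite mxE expr0n.
have [x [y [x0 y0]]] := iD.
have ge0 u : 0 <= c * bform D u u by rewrite -bformZm -cE bE sqr_ge0.
have c0 : c = 0.
  have := ge0 x; have := ge0 y; rewrite nmulr_lge0 // pmulr_lge0 // => c1 c2.
  by apply/eqP; rewrite eq_le c1.
apply: mulmx_tr_self_eq0; apply/mx11_eq0/eqP; rewrite -sqrf_eq0 -bE cE c0.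
by rewrite bformZm mul0r.
Qed.

Lemma exists_isotropic n (D : 'M[R]_n) :
  D^T = D -> indefinite D -> exists2 u, u != 0 & bform D u u = 0.
Proof.
move=> sD iD; apply: contrapT => noz; have [x [_ [+ _]]] := iD.
suff -> : x = 0 by rewrite bform0 ltxx.
apply: (zeros_not_in_hyperplane sD iD) => u Du.
suff -> : u = 0 by rewrite mul0mx.
by apply/eqP; apply/negPn/negP => u0; apply: noz; exists u.
Qed.

(** * Surfaces and their tangent planes *)

Lemma scalar_mul_sym n (A D : 'M[R]_n) c :
  A^T = A -> D^T = D -> A *m D = c%:M -> D *m A = c%:M.
Proof.
by move=> sA sD AD; rewrite -[D]sD -[A]sA -trmx_mul AD tr_scalar_mx.
Qed.

Lemma kernel_of_scalar_mul n (A D : 'M[R]_n) (c : R) (l : 'rV[R]_n) :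
    A^T = A -> D^T = D -> A *m D = c%:M -> c != 0 -> l *m D = 0 -> l = 0.
Proof.
move=> sA sD AD c0 lD; apply/eqP.
have : c *: l = 0.
  by rewrite -mul_mx_scalar -(scalar_mul_sym sA sD AD) mulmxA lD mul0mx.
by move/eqP; rewrite scaler_eq0 (negbTE c0).
Qed.

(** This is tangency to a surface as a relation between rows of any length, with
    [u = 0] admitted, so that it applies to plane conics too, and to the image of
    the plane of a conic under projection. *)
Definition contact n (A : 'M[R]_n) (u p : 'rV[R]_n) : Prop :=
  [/\ p *m A *m p^T = 0, p *m A != 0 & (u <= p *m A)%MS].

(** Here [D] is, up to a factor, the inverse of [A]; the plane [u] touches the
    surface at [u *m D]. *)
Lemma contact_eq_zeros n (A D : 'M[R]_n) c u :
    A^T = A -> D^T = D -> A *m D = c%:M -> c != 0 -> u != 0 ->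
  (exists p, contact A u p) <-> bform D u u = 0.
Proof.
move=> sA sD AD c0 u0; split=> [[p [pAp _ /sub_rVP[a ->]]]|Du].
  apply/bform_eq0; rewrite linearZ /= -!scalemxAl -scalemxAr trmx_mul sA.
  by rewrite -(mulmxA p) AD mul_mx_scalar -scalemxAl mulmxA pAp !scaler0.
have DA := scalar_mul_sym sA sD AD.
have uDA : u *m D *m A = c *: u by rewrite -mulmxA DA mul_mx_scalar.
exists (u *m D); split.
- rewrite uDA trmx_mul sD -scalemxAl mulmxA.
  by move/bform_eq0: Du => ->; rewrite scaler0.
- by rewrite uDA scaler_eq0 negb_or c0.
- by rewrite uDA; apply/sub_rVP; exists c^-1; rewrite scalerA mulVf // scale1r.
Qed.

(** A row in the kernel of [A] would be a point lying on all tangent planes, so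
    [A] is invertible; then its inverse and [D] have the same zeros. *)
Lemma inverse_of_contact_planes n (A D : 'M[R]_n) :
    A^T = A -> D^T = D -> indefinite D ->
    (forall u, u != 0 -> (exists p, contact A u p) <-> bform D u u = 0) ->
  exists2 c, c != 0 & A *m D = c%:M.
Proof.
move=> sA sD iD AD.
have Au : A \in unitmx.
  rewrite -row_free_unit -kermx_eq0; apply/rowV0P=> v /sub_kermxP vA.
  apply: (zeros_not_in_hyperplane sD iD) => u Du.
  have [->|u0] := eqVneq u 0; first by rewrite mul0mx.
  have [p [_ _ /sub_rVP[a ->]]] := (AD u u0).2 Du.
  by rewrite -scalemxAl -mulmxA -{1}sA -trmx_mul vA trmx0 mulmx0 scaler0.
have sAV : (invmx A)^T = invmx A by rewrite trmx_inv sA.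
have [u|c cE] := proportional_of_zeros sD sAV iD.
  have [->|u0] := eqVneq u 0; first by rewrite !bform0.
  by move/(AD u u0); rewrite (contact_eq_zeros sA sAV (mulmxV Au) (oner_neq0 _) u0).
have c0 : c != 0.
  apply/eqP => c0; have [x [_ [+ _]]] := iD.
  rewrite -[x](mulmx1) -(mulmxV Au) cE c0 scale0r mulmx0.
  by rewrite mulmx0 bform0 ltxx.
exists c^-1; first by rewrite invr_eq0.
have -> : D = c^-1 *: invmx A by rewrite cE scalerA mulVf // scale1r.
by rewrite -scalemxAr mulmxV // scale_scalar_mx mulr1.
Qed.

Lemma points_of_contact_planes n (A A0 D : 'M[R]_n) c :
    A^T = A -> D^T = D -> indefinite D -> A0 *m D = c%:M -> c != 0 ->
    (forall u, u != 0 -> (exists p, contact A u p) <-> bform D u u = 0) ->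
  forall p : 'rV[R]_n, p *m A *m p^T = 0 <-> p *m A0 *m p^T = 0.
Proof.
move=> sA sD iD A0D c0 AD p.
have [d d0 AdD] := inverse_of_contact_planes sA sD iD AD.
have -> : A = (d / c) *: A0.
  have DA := scalar_mul_sym sA sD AdD.
  have cA : c *: A = d *: A0.
    by rewrite -mul_scalar_mx -A0D -mulmxA DA mul_mx_scalar.
  by rewrite mulrC -scalerA -cA scalerA mulVf // scale1r.
rewrite -scalemxAr -scalemxAl; split=> [/eqP|->]; last by rewrite scaler0.
by rewrite scaler_eq0 mulf_eq0 invr_eq0 (negbTE d0) (negbTE c0) => /eqP.
Qed.

(** * Conics and their tangent planes *)

Definition conic_contact n (l : 'rV[R]_n) (A : 'M[R]_n) (u p : 'rV[R]_n) : Prop :=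
  (p *m A *m p^T = 0 /\ l *m p^T = 0) /\
  (row_free (col_mx (p *m A) l) /\ (u <= col_mx (p *m A) l)%MS).

(** The planes through a tangent line of the conic form a pencil containing [l].
    So [D] vanishes at [u], [l] and [u + l] for each tangent plane [u], whence
    [bform D u l = 0]; and the tangent planes [u] lie in no hyperplane. *)
Lemma conic_kernel n (A D : 'M[R]_n) (l : 'rV[R]_n) :
    D^T = D -> indefinite D -> l != 0 ->
    (forall u, u != 0 -> (exists p, conic_contact l A u p) <-> bform D u u = 0) ->
  l *m D = 0.
Proof.
move=> sD iD l0 AD; apply: (zeros_not_in_hyperplane sD iD) => u Du.
rewrite trmx_mul sD mulmxA; apply/mx11_eq0; rewrite -/(bform D u l).
have [->|u0] := eqVneq u 0; first by rewrite !bform0.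
have [p [onp [freep up]]] := (AD u u0).2 Du.
have lp : (l <= col_mx (p *m A) l)%MS by rewrite -addsmxE addsmxSr.
have Dl : bform D l l = 0 by apply/(AD l l0); exists p.
have Dul : bform D (u + 1 *: l) (u + 1 *: l) = 0.
  rewrite scale1r; have [->|ul0] := eqVneq (u + l) 0.
    by rewrite bform0.
  by apply/(AD _ ul0); exists p; split=> //; split=> //; exact: addmx_sub.
move: Dul; rewrite bform_line // Du Dl => e; lra.
Qed.

End Forms.

(** The rows of [P] are an orthonormal basis of the points of the plane [l].
    Thus [q *m P] is the point with coordinates [q] in this plane, and [u *m P^T]
    is the trace of the plane [u] on it, in the dual coordinates. *)
Section Conics.
Variables (R : rcfType) (m n : nat) (P : 'M[R]_(m, n)) (l : 'rV[R]_n).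
Hypotheses (PPt : P *m P^T = 1%:M) (l0 : l != 0).
Hypothesis kerP : forall u : 'rV[R]_n, u *m P^T = 0 <-> (u <= l)%MS.

Lemma pencil_sub (a u : 'rV[R]_n) :
  (u <= col_mx a l)%MS = (u *m P^T <= a *m P^T)%MS.
Proof.
rewrite -addsmxE; apply/sub_addsmxP/submxP => [[[x y] /= ->]|[x e]].
  exists x; rewrite mulmxDl -[y *m l *m _]mulmxA.
  by rewrite ((kerP l).2 (submx_refl _)) mulmx0 addr0 mulmxA.
have /submxP[y ye] : (u - x *m a <= l)%MS.
  by apply/kerP; rewrite mulmxBl e mulmxA subrr.
by exists (x, y); rewrite /= -ye addrC subrK.
Qed.

Lemma pencil_free (a : 'rV[R]_n) : row_free (col_mx a l) = (a *m P^T != 0).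
Proof.
apply/idP/idP => [|aP].
  apply: contraTneq => /kerP al.
  rewrite /row_free -addsmxE (eqmxP (_ : (a + l == l)%MS)).
    by rewrite rank_rV l0.
  by rewrite addsmx_sub al submx_refl addsmxSr.
rewrite -kermx_eq0; apply/rowV0P=> v /sub_kermxP.
rewrite -[v]hsubmxK mul_row_col; set x := lsubmx v; set y := rsubmx v => e.
have x0 : x = 0.
  have := congr1 (mulmx^~ P^T) e.
  rewrite /= mulmxDl mul0mx -[y *m l *m _]mulmxA.
  rewrite ((kerP l).2 (submx_refl _)) mulmx0 addr0 -mulmxA.
  rewrite [x]mx11_scalar mul_scalar_mx => /eqP.
  by rewrite scaler_eq0 (negbTE aP) orbF => /eqP ->; rewrite raddf0.
move: e; rewrite x0 mul0mx add0r [y]mx11_scalar mul_scalar_mx => /eqP.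
rewrite scaler_eq0 (negbTE l0) orbF => /eqP ->.
by rewrite raddf0 row_mx0.
Qed.

Lemma plane_points (p : 'rV[R]_n) : l *m p^T = 0 <-> exists q, p = q *m P.
Proof.
have Pl : P *m l^T = 0.
  by rewrite -[P]trmxK -trmx_mul ((kerP l).2 (submx_refl _)) trmx0.
split=> [lp|[q ->]]; last first.
  by rewrite trmx_mul mulmxA ((kerP l).2 (submx_refl _)) mul0mx.
exists (p *m P^T); apply/eqP; rewrite -subr_eq0; apply/eqP/mulmx_tr_self_eq0.
have /sub_rVP[b be] : (p - p *m P^T *m P <= l)%MS.
  by apply/kerP; rewrite mulmxBl -(mulmxA _ P) PPt mulmx1 subrr.
rewrite {2}be linearZ /= -scalemxAr mulmxBl -(mulmxA _ P) Pl mulmx0 subr0.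
by rewrite -[p]trmxK -trmx_mul lp trmx0 scaler0.
Qed.

(** [P^T *m P] is the orthogonal projection along [l]. *)
Lemma project_kernel (D : 'M[R]_n) : l *m D = 0 -> P^T *m P *m D = D.
Proof.
move=> lD; apply/row_matrixP=> i; rewrite !rowE.
set u := delta_mx 0 i.
have /sub_rVP[b be] : (u - u *m P^T *m P <= l)%MS.
  by apply/kerP; rewrite mulmxBl -(mulmxA _ P) PPt mulmx1 subrr.
apply/eqP; rewrite eq_sym -subr_eq0 !mulmxA -mulmxBl be -scalemxAl lD.
by rewrite scaler0.
Qed.

Lemma restrict_bform (D : 'M[R]_n) (u : 'rV[R]_n) : D^T = D -> l *m D = 0 ->
  bform (P *m D *m P^T) (u *m P^T) (u *m P^T) = bform D u u.
Proof.
move=> sD /project_kernel PD.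
have DP : D *m P^T *m P = D.
  by rewrite -{1}sD -(trmxK P) -!trmx_mul trmxK mulmxA PD sD.
rewrite /bform trmx_mul trmxK -!mulmxA.
rewrite (mulmxA P^T P) (mulmxA (P^T *m P) D) PD.
by rewrite (mulmxA P^T P) (mulmxA D) (mulmxA D) DP.
Qed.

Lemma restrict_indefinite (D : 'M[R]_n) : D^T = D -> l *m D = 0 ->
  indefinite D -> indefinite (P *m D *m P^T).
Proof.
move=> sD lD [x [y xy]]; exists (x *m P^T), (y *m P^T).
by rewrite !restrict_bform.
Qed.

Lemma restrict_sym (D : 'M[R]_n) :
  D^T = D -> (P *m D *m P^T)^T = P *m D *m P^T.
Proof. by move=> sD; rewrite !trmx_mul trmxK sD mulmxA. Qed.

(** A plane touches the conic exactly when its trace on the plane of the conic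
    does so within that plane; this reduces conics to surfaces of one dimension
    less. *)
Lemma conic_contact_restrict (A : 'M[R]_n) (u : 'rV[R]_n) :
  (exists p, conic_contact l A u p) <->
  (exists q, contact (P *m A *m P^T) (u *m P^T) q).
Proof.
split=> [[p [[pAp /plane_points[q pE]]]]|[q [qAq qA uq]]].
  rewrite pencil_free pencil_sub pE => -[qA uq]; exists q.
  split; rewrite ?mulmxA //.
  by rewrite -(mulmxA (q *m P *m A)) -trmx_mul -pE.
exists (q *m P); rewrite /conic_contact pencil_free pencil_sub.
rewrite trmx_mul; rewrite !mulmxA in qAq qA uq *.
split; split=> //.
by rewrite -mulmxA -trmx_mul; apply/plane_points; exists q.
Qed.

Section DualConic.
Variables (D A0 : 'M[R]_n) (c : R).
Hypotheses (sD : D^T = D) (iD : indefinite D) (lD : l *m D = 0).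
Hypotheses (sA0 : A0^T = A0) (A0D : P *m A0 *m D *m P^T = c%:M) (c0 : c != 0).

Lemma restrict_inverse : P *m A0 *m P^T *m (P *m D *m P^T) = c%:M.
Proof.
by rewrite -A0D -!mulmxA (mulmxA P^T P) (mulmxA (P^T *m P)) project_kernel.
Qed.

(** The plane [l] has trace 0 and touches the conic along any of its tangent
    lines, so that case needs the conic to have a real regular point; this is
    where the indefiniteness of [D] enters. *)
Lemma conic_contact_eq_zeros (u : 'rV[R]_n) :
  (exists p, conic_contact l A0 u p) <-> bform D u u = 0.
Proof.
rewrite conic_contact_restrict -restrict_bform //.
have cE := contact_eq_zeros (restrict_sym sA0) (restrict_sym sD) restrict_inverse c0.
have [->|w0] := eqVneq (u *m P^T) 0; last exact: cE.
split=> _; first by rewrite !bform0.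
have [w w0 Dw] := exists_isotropic (restrict_sym sD) (restrict_indefinite sD lD iD).
have [q [qAq qA _]] := (cE w w0).2 Dw.
by exists q; split=> //; rewrite sub0mx.
Qed.

Lemma conic_points_of_contact_planes (A : 'M[R]_n) : A^T = A ->
    (forall u, u != 0 -> (exists p, conic_contact l A u p) <-> bform D u u = 0) ->
  forall p : 'rV[R]_n, l *m p^T = 0 -> p *m A *m p^T = 0 <-> p *m A0 *m p^T = 0.
Proof.
move=> sA AD p /plane_points[q ->].
have := points_of_contact_planes (restrict_sym sA) (restrict_sym sD)
  (restrict_indefinite sD lD iD) restrict_inverse c0.
have h w : w != 0 -> (exists p, contact (P *m A *m P^T) w p) <->
    bform (P *m D *m P^T) w w = 0.
  have wE : w = w *m P *m P^T by rewrite -mulmxA PPt mulmx1.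
  move=> w0; rewrite wE -conic_contact_restrict restrict_bform //; apply: AD.
  by apply: contraNneq w0 => e; rewrite wE e mul0mx.
by move=> /(_ h q); rewrite trmx_mul !mulmxA.
Qed.

End DualConic.

End Conics.

(** * The dual form determines the point set *)

Section Inscribed.
Variable R : realType.

Definition drop_coord n (k : 'I_n.+1) : 'M[R]_(n, n.+1) := row' k 1%:M.

Lemma tr_drop_coord n (k : 'I_n.+1) :
  (drop_coord k)^T = colsub (lift k) 1%:M.
Proof. by apply/matrixP=> i j; rewrite !mxE eq_sym. Qed.

Lemma mulmx_drop_coord n (k : 'I_n.+1) (u : 'rV[R]_n.+1) :
  u *m (drop_coord k)^T = col' k u.
Proof. by rewrite tr_drop_coord mulmx_colsub mulmx1. Qed.

Lemma drop_coordK n (k : 'I_n.+1) : drop_coord k *m (drop_coord k)^T = 1%:M.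
Proof.
rewrite tr_drop_coord mulmx_colsub mulmx1.
by apply/matrixP=> i j; rewrite !mxE (inj_eq (@lift_inj _ k)).
Qed.

Lemma drop_coord_eq0 n (k : 'I_n.+1) (u : 'rV[R]_n.+1) :
  u *m (drop_coord k)^T = 0 <-> (u <= (delta_mx 0 k : 'rV_n.+1))%MS.
Proof.
rewrite mulmx_drop_coord; split=> [/rowP u0|/sub_rVP[b ->]].
  apply/sub_rVP; exists (u 0 k); apply/rowP=> i; rewrite !mxE /=.
  case: (unliftP k i) => [j ->|->]; last by rewrite eqxx mulr1.
  by have := u0 j; rewrite !mxE eq_sym (negbTE (neq_lift k j)) mulr0.
by apply/rowP=> i; rewrite !mxE /= eq_sym (negbTE (neq_lift k i)) mulr0.
Qed.

Lemma drop_coord_conj n (k : 'I_n.+1) (M : 'M[R]_n.+1) :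
  drop_coord k *m M *m (drop_coord k)^T = mxsub (lift k) (lift k) M.
Proof.
rewrite tr_drop_coord mulmx_colsub mulmx1.
have -> : drop_coord k = rowsub (lift k) 1%:M by [].
rewrite mul_rowsub_mx mul1mx.
by apply/matrixP=> i j; rewrite !mxE.
Qed.

Lemma row_free_rV n (v : 'rV[R]_n) : row_free v = (v != 0).
Proof. by rewrite /row_free rank_rV; case: (v != 0). Qed.

Lemma surface_tangent (A : 'M[R]_4) (sA : A^T = A) (A0 : A != 0) u :
  u != 0 -> tangent_plane (Surface sA A0) u <-> exists p, contact A u p.
Proof.
move=> u0; split=> [[_ [p [onp []]]]|[p [onp pA up]]].
  by rewrite row_free_rV; exists p.
by split=> //; exists p; split=> //; rewrite row_free_rV.
Qed.

Lemma conic_tangent (A : 'M[R]_4) l (sA : A^T = A) (A0 : A != 0)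
    (l0 : l != 0) u :
  u != 0 -> tangent_plane (Conic sA A0 l0) u <-> exists p, conic_contact l A u p.
Proof. by move=> u0; split=> [[]|]. Qed.

(** An invertible dual form: conics are excluded because their plane would be in
    the kernel of [D]. *)
Lemma inscribed_surface (lam : \bar R) (A D : 'M[R]_4) c S :
    A^T = A -> D^T = D -> indefinite D -> A *m D = c%:M -> c != 0 ->
    (forall u, system_form lam u = bform D u u) ->
  inscribed_quadric lam S <->
  S = [set q | bform A (homogeneous q) (homogeneous q) = 0]%classic.
Proof.
move=> sA sD iD AD c0 lamD; split=> [[X [->]]|->].
  case: X => [B sB B0|B l sB B0 l0] tanX.
    apply/predeqP=> q /=; rewrite -bform_eq0.
    apply: (points_of_contact_planes sB sD iD AD c0) => u u0.
    by rewrite -lamD -tanX //; symmetry; exact: surface_tangent.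
  case/eqP: (l0); apply: (kernel_of_scalar_mul sA sD AD c0).
  apply: (@conic_kernel _ _ B) => // u u0.
  by rewrite -lamD -tanX //; symmetry; exact: conic_tangent.
have A0 : A != 0.
  apply: contraNneq c0 => A0; have /matrixP/(_ 0 0) := AD.
  by rewrite A0 mul0mx !mxE eqxx mulr1n => <-.
exists (Surface sA A0); split; first by apply/predeqP=> q /=; rewrite -bform_eq0.
by move=> u u0; rewrite lamD -(contact_eq_zeros sA sD AD c0 u0); exact: surface_tangent.
Qed.

(** A dual form whose kernel is a coordinate plane: surfaces are excluded because
    [D] would be invertible. *)
Lemma inscribed_conic (lam : \bar R) (A D : 'M[R]_4) (k : 'I_4) c S :
    A^T = A -> D^T = D -> indefinite D ->
    (delta_mx 0 k : 'rV[R]_4) *m D = 0 ->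
    drop_coord k *m A *m D *m (drop_coord k)^T = c%:M -> c != 0 ->
    (forall u, system_form lam u = bform D u u) ->
  inscribed_quadric lam S <->
  S = [set q | bform A (homogeneous q) (homogeneous q) = 0
             /\ homogeneous q 0 k = 0]%classic.
Proof.
move=> sA sD iD eD AD c0 lamD.
set e : 'rV[R]_4 := delta_mx 0 k in eD *.
have e0 : e != 0.
  by apply/eqP => /rowP/(_ k)/eqP; rewrite !mxE !eqxx oner_eq0.
(* The kernel is no larger than [e], because [A] inverts [D] on the traces. *)
have kerD (l : 'rV[R]_4) : l *m D = 0 -> (l <= e)%MS.
  move=> lD; apply/drop_coord_eq0; set P := drop_coord k in AD *.
  have PD := project_kernel (drop_coordK k) (@drop_coord_eq0 _ k) eD.
  have DA : P *m D *m A *m P^T = c%:M.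
    by rewrite -(tr_scalar_mx _ c) -AD !trmx_mul trmxK sA sD !mulmxA.
  apply/eqP; have : c *: (l *m P^T) = 0.
    rewrite -mul_mx_scalar -DA !mulmxA.
    by rewrite -(mulmxA l) -(mulmxA l) PD lD !mul0mx.
  by move/eqP; rewrite scaler_eq0 (negbTE c0).
have ep (p : 'rV[R]_4) : e *m p^T = 0 <-> p 0 k = 0.
  by rewrite -rowE mx11_eq0 !mxE.
split=> [[X [->]]|->].
  case: X => [B sB B0|B l sB B0 l0] tanX.
    have [|d d0 BD] := inverse_of_contact_planes sB sD iD.
      move=> u u0; rewrite -lamD -tanX //; symmetry; exact: surface_tangent.
    by case/eqP: (e0); apply: (kernel_of_scalar_mul sB sD BD d0).
  have BD u : u != 0 -> (exists p, conic_contact l B u p) <-> bform D u u = 0.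
    by move=> u0; rewrite -lamD -tanX //; symmetry; exact: conic_tangent.
  have lD := conic_kernel sD iD l0 BD.
  have /sub_rVP[b lE] := kerD l lD.
  have b0 : b != 0 by apply/eqP => b0; case/eqP: (l0); rewrite lE b0 scale0r.
  have kerl (u : 'rV[R]_4) : u *m (drop_coord k)^T = 0 <-> (u <= l)%MS.
    by rewrite drop_coord_eq0 lE (eqmx_scale _ b0).
  have le (p : 'rV[R]_4) : l *m p^T = 0 <-> p 0 k = 0.
    rewrite -ep lE -scalemxAl; split=> [/eqP|->]; last by rewrite scaler0.
    by rewrite scaler_eq0 (negbTE b0) => /eqP.
  have pts := conic_points_of_contact_planes (drop_coordK k) l0 kerl sD iD lD AD c0 sB BD.
  apply/predeqP=> q /=; rewrite -bform_eq0 -le.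
  by split=> -[q1 q2]; split=> //; apply/pts.
have A0 : A != 0.
  apply: contraNneq c0 => A0; have /matrixP/(_ 0 0) := AD.
  by rewrite A0 mulmx0 !mul0mx !mxE eqxx mulr1n => <-.
exists (Conic sA A0 e0); split.
  by apply/predeqP=> q /=; rewrite -bform_eq0 ep.
move=> u u0; rewrite lamD.
rewrite -(conic_contact_eq_zeros (drop_coordK k) e0 (@drop_coord_eq0 _ k)
            sD iD eD sA AD c0).
exact: conic_tangent.
Qed.

(** * The tangential system of the two circles *)

(** All matrices below, in point as in plane coordinates, have this shape: the
    symmetry of the two circles in the planes [x = 0] and [z = 0] leaves a block
    on the coordinates 0 and 2 and two diagonal entries. *)
Definition axial_mx (a b c d e : R) : 'M[R]_4 :=
  \matrix_(i, j) nth 0 (nth [::] [:: [:: a; 0; b; 0]; [:: 0; d; 0; 0];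
                                     [:: b; 0; c; 0]; [:: 0; 0; 0; e]] i) j.

Lemma sum_ord4 (F : 'I_4 -> R) : \sum_(i < 4) F i = F 0 + F 1 + F 2 + F 3.
Proof.
rewrite !big_ord_recl big_ord0 addr0 !addrA.
by congr (F _ + F _ + F _ + F _); apply: val_inj.
Qed.

Lemma axial_mx_sym a b c d e : (axial_mx a b c d e)^T = axial_mx a b c d e.
Proof.
by apply/matrixP=> -[[|[|[|[|//]]]] ?] [[|[|[|[|//]]]] ?]; rewrite !mxE.
Qed.

Lemma bform_axial a b c d e u v :
  bform (axial_mx a b c d e) u v =
  a * u 0 0 * v 0 0 + b * u 0 0 * v 0 2 + b * u 0 2 * v 0 0 + c * u 0 2 * v 0 2
  + d * u 0 1 * v 0 1 + e * u 0 3 * v 0 3.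
Proof.
rewrite /bform mxE sum_ord4 !mxE !sum_ord4 !mxE /=; ring.
Qed.

Lemma mul_axial a b c d e a' b' c' d' e' :
    a * b' + b * c' = 0 -> b * a' + c * b' = 0 ->
  axial_mx a b c d e *m axial_mx a' b' c' d' e' =
  axial_mx (a * a' + b * b') 0 (b * b' + c * c') (d * d') (e * e').
Proof.
move=> h1 h2; apply/matrixP=> -[[|[|[|[|//]]]] ?] [[|[|[|[|//]]]] ?];
  rewrite !mxE sum_ord4 !mxE /= ?(mul0r, mulr0, add0r, addr0) //.
Qed.

Lemma axial_scalar c : axial_mx c 0 c c c = c%:M.
Proof.
by apply/matrixP=> -[[|[|[|[|//]]]] ?] [[|[|[|[|//]]]] ?]; rewrite !mxE.
Qed.

Definition system_mx (l : R) : 'M[R]_4 :=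
  axial_mx 4 (2 * (2 * l - 1)) (-3) (- (4 * (1 - l))) (- (4 * l)).

(** The matrix of [f l] in homogeneous coordinates.  For [l = 0] and [l = 1] the
    convention [0^-1 = 0] makes it the cylinder over the circle. *)
Definition quadric_mx (l : R) : 'M[R]_4 :=
  let q := 1 - l + l ^+ 2 in
  axial_mx (- (3 / (4 * q))) ((2^-1 - l) / q) q^-1 (1 - l)^-1 l^-1.

Lemma denominator_gt0 (l : R) : 0 < 1 - l + l ^+ 2.
Proof.
have -> : 1 - l + l ^+ 2 = (l - 2^-1) ^+ 2 + 3 / 4 by field.
have := sqr_ge0 (l - 2^-1); lra.
Qed.

Lemma system_formE l u : system_form l%:E u = bform (system_mx l) u u.
Proof. by rewrite bform_axial /= /F0 /F1; ring. Qed.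

(** The plane at infinity and the plane [y = 0] give values of opposite signs for
    all parameters. *)
Lemma system_mx_indefinite l : indefinite (system_mx l).
Proof.
exists (delta_mx 0 0), (delta_mx 0 2); rewrite !bform_delta !mxE /=; split; lra.
Qed.

(** The last two entries are left unsimplified: they are -4 unless [l] is 1,
    respectively 0, in which case they vanish. *)
Lemma mul_quadric_system l : quadric_mx l *m system_mx l =
  axial_mx (-4) 0 (-4) ((1 - l)^-1 * - (4 * (1 - l))) (l^-1 * - (4 * l)).
Proof.
have q0 := lt0r_neq0 (denominator_gt0 l).
rewrite mul_axial; [congr axial_mx; by field | by field | by field].
Qed.

Lemma homogeneousE (q : 'rV[R]_3) : (homogeneous q 0 0 = 1) *
  (homogeneous q 0 1 = q 0 0) * (homogeneous q 0 2 = q 0 1) *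
  (homogeneous q 0 3 = q 0 2).
Proof.
have h0 : homogeneous q 0 (lshift 3 (0 : 'I_1)) = 1.
  by apply: etrans (row_mxEl _ _ _ _) _; rewrite mxE.
have hS i : homogeneous q 0 (rshift 1 i) = q 0 i by exact: row_mxEr.
by rewrite -h0 -!hS; do !split; congr (homogeneous q 0 _); apply: val_inj.
Qed.

Lemma bform_quadric_mx l q :
  bform (quadric_mx l) (homogeneous q) (homogeneous q) = f l q.
Proof.
rewrite bform_axial !homogeneousE /f.
have q0 := lt0r_neq0 (denominator_gt0 l).
(* Generalizing the inverses keeps [field] from requiring [l] and [1 - l] to be
   nonzero. *)
by move: (1 - l)^-1 l^-1 => i j; field.
Qed.

Lemma inscribed_finite (l : R) (S : set 'rV[R]_3) : l != 0 -> l != 1 ->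
  inscribed_quadric l%:E S <-> S = [set q | f l q = 0]%classic.
Proof.
move=> l0 l1; have m0 : 1 - l != 0 by rewrite subr_eq0 eq_sym.
rewrite (@inscribed_surface l%:E (quadric_mx l) (system_mx l) (-4)).
- by under eq_set do rewrite bform_quadric_mx.
- exact: axial_mx_sym.
- exact: axial_mx_sym.
- exact: system_mx_indefinite.
- by rewrite mul_quadric_system -axial_scalar; congr axial_mx; field.
- by rewrite oppr_eq0 pnatr_eq0.
- exact: system_formE.
Qed.

Lemma inscribed_0 (S : set 'rV[R]_3) :
  inscribed_quadric (0 : R)%:E S <-> S = @circle_A R.
Proof.
rewrite (@inscribed_conic (0 : R)%:E (quadric_mx 0) (system_mx 0) 3 (-4)).
- suff -> : (@circle_A R) = [set q | bform (quadric_mx 0) (homogeneous q)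
    (homogeneous q) = 0 /\ homogeneous q 0 3 = 0]%classic by [].
  apply/predeqP=> q /=; rewrite bform_quadric_mx homogeneousE /f.
  rewrite !subr0 expr0n addr0 !invr1 !mulr1 invr0 mulr0 addr0 /=.
  by split=> -[q1 q2]; split=> //; lra.
- exact: axial_mx_sym.
- exact: axial_mx_sym.
- exact: system_mx_indefinite.
- rewrite -rowE; apply/rowP=> -[[|[|[|[|//]]]] ?]; rewrite !mxE //=; ring.
- rewrite -(mulmxA (drop_coord _)) mul_quadric_system drop_coord_conj.
  apply/matrixP=> -[[|[|[|//]]] ?] [[|[|[|//]]] ?];
    by rewrite !mxE /= ?subr0 ?invr1 ?mulr1 ?mul1r.
- by rewrite oppr_eq0 pnatr_eq0.
- exact: system_formE.
Qed.

Lemma inscribed_1 (S : set 'rV[R]_3) :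
  inscribed_quadric (1 : R)%:E S <-> S = @circle_B R.
Proof.
rewrite (@inscribed_conic (1 : R)%:E (quadric_mx 1) (system_mx 1) 1 (-4)).
- suff -> : (@circle_B R) = [set q | bform (quadric_mx 1) (homogeneous q)
    (homogeneous q) = 0 /\ homogeneous q 0 1 = 0]%classic by [].
  apply/predeqP=> q /=; rewrite bform_quadric_mx homogeneousE /f.
  rewrite subrr invr0 mulr0 !add0r expr1n !invr1 !mulr1.
  by split=> -[q1 q2]; split=> //; lra.
- exact: axial_mx_sym.
- exact: axial_mx_sym.
- exact: system_mx_indefinite.
- rewrite -rowE; apply/rowP=> -[[|[|[|[|//]]]] ?]; rewrite !mxE //=; ring.
- rewrite -(mulmxA (drop_coord _)) mul_quadric_system drop_coord_conj.
  apply/matrixP=> -[[|[|[|//]]] ?] [[|[|[|//]]] ?];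
    by rewrite !mxE /= ?subr0 ?invr1 ?mulr1 ?mul1r.
- by rewrite oppr_eq0 pnatr_eq0.
- exact: system_formE.
Qed.

Lemma inscribed_infty (lam : \bar R) (S : set 'rV[R]_3) :
    (forall u, system_form lam u = F1 u - F0 u) ->
  inscribed_quadric lam S <->
  S = [set p : 'rV[R]_3 | p 0 0 ^+ 2 - p 0 2 ^+ 2 + 2 * p 0 1 = 0]%classic.
Proof.
move=> lamE.
rewrite (@inscribed_surface lam (axial_mx 0 1 0 1 (-1))
  (axial_mx 0 4 0 4 (-4)) 4).
- suff -> : [set p : 'rV[R]_3 | p 0 0 ^+ 2 - p 0 2 ^+ 2 + 2 * p 0 1 = 0]%classic
    = [set q | bform (axial_mx 0 1 0 1 (-1)) (homogeneous q)
    (homogeneous q) = 0]%classic by [].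
  apply/predeqP=> q /=; rewrite bform_axial !homogeneousE.
  by split=> e; lra.
- exact: axial_mx_sym.
- exact: axial_mx_sym.
- exists (delta_mx 0 1), (delta_mx 0 3).
  by rewrite !bform_delta !mxE /=; split; lra.
- by rewrite mul_axial -?axial_scalar; [congr axial_mx; ring | ring | ring].
- by rewrite pnatr_eq0.
- by move=> u; rewrite lamE bform_axial /F0 /F1; ring.
Qed.

End Inscribed.

Theorem theorem1 (R : realType) (lam : \bar R) (S : set 'rV[R]_3) :
  inscribed_quadric lam S <-> S = Q lam.
Proof.
case: lam => [l| |]; [|exact: inscribed_infty|exact: inscribed_infty].
rewrite /Q; have [->|l0] := eqVneq l 0; first exact: inscribed_0.
have [->|l1] := eqVneq l 1; first exact: inscribed_1.
exact: inscribed_finite.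
Qed.
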